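(* Let $\mathcal{H}$ be a real Hilbert space, let $F:\mathcal{H}\rightrightarrows\mathcal{H}$ be a set-valued mapping with $\operatorname{zer}F\ne\varnothing$, and let $v:\mathcal{H}\to\mathcal{H}$ be a single-valued mapping defined on all of $\mathcal{H}$ such that the pair $(F,v)$ is monotone and $\operatorname{ran}(\gamma F+v)=\mathcal{H}$ for some $\gamma>0$. Let $x_0\in\mathcal{H}$ and $x\in\mathcal{H}$, and let $(x_k)$ be the sequence generated by $$x_{k+1}=\alpha_kx+(1-\alpha_k)T_{\gamma F}^v(x_k),\qquad k=0,1,2,\dots,$$ where $(\alpha_n)_{n\in\mathbb{N}}$ is a sequence of real numbers. Then $(x_k)$ converges strongly to some point $\tilde x$ such that $v^{-1}(\tilde x)$ contains a solution of the inclusion $0\in F(z)$, provided that $$\lim_{n\to\infty}\alpha_n=0,\qquad \sum_{n=0}^\infty\alpha_n=\infty,\qquad \sum_{n=0}^\infty|\alpha_{n+1}-\alpha_n|<\infty.$$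
   Context: For a set-valued mapping $F:\mathcal{H}\rightrightarrows\mathcal{H}$: $\operatorname{ran}F=\bigcup_xF(x)$, $\operatorname{zer}F=\{x:0\in F(x)\}$, $F^{-1}(y)=\{x:y\in F(x)\}$. Here $v^{-1}(\tilde x)=\{z\in\mathcal{H}:v(z)=\tilde x\}$; $v$ is not assumed injective. Transformed resolvent: $T_{\gamma F}^v=v\circ(\gamma F+v)^{-1}$, i.e. $T_{\gamma F}^v(x)=\{v(z): x\in\gamma F(z)+v(z)\}$, with domain $\operatorname{ran}(\gamma F+v)$. When $(F,v)$ is monotone it is single-valued on its domain, and $T_{\gamma F}^v(x)$ denotes the unique element. The pair $(F,v)$ is monotone if $\langle x^*-y^*, v(x)-v(y)\rangle\ge 0$ for all $x,y\in\mathcal{H}$, $x^*\in F(x)$, $y^*\in F(y)$.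
   Formalization: The formal theorem additionally assumes that the negative parts max(-α_n, 0) are summable (automatic if α_n ≥ 0); for arbitrary real α_n the claim fails, e.g. F the normal cone of [0,1] in the real line, v = id, x = 2, with α_n alternating in sign over long blocks. *)

(* Defs.v *)
From mathcomp Require Export all_boot all_order all_algebra.
From mathcomp Require Export sesquilinear.
From mathcomp Require Export all_classical all_reals all_analysis.
Export Order.TTheory GRing.Theory Num.Theory.
Export numFieldNormedType.Exports.

#[export] Set Implicit Arguments.
#[export] Unset Strict Implicit.
#[export] Unset Printing Implicit Defensive.

Local Open Scope classical_set_scope.
Local Open Scope ring_scope.

(* A real Hilbert space is a complete normed module H together with a real
   inner product that induces its norm. *)
Definition induces_norm (R : realType) (H : normedModType R)
    (dotp : {dot H for idfun}) : Prop :=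
  forall u : H, dotp u u = `|u| ^+ 2.

Section SetValuedMaps.
Variables (R : realType) (H : normedModType R).
Implicit Types (F : H -> set H) (v : H -> H) (gamma : R).

Definition ran F : set H := \bigcup_(x in [set: H]) F x.

Definition zer F : set H := [set x | F x 0].

Definition svinv F : H -> set H := fun y => [set x | F x y].

(* gamma F + v *)
Definition scale_add gamma F v : H -> set H :=
  fun z => [set gamma *: u + v z | u in F z].

(* the set-valued map v \o (gamma F + v)^-1 *)
Definition tresolvent_set gamma F v : H -> set H :=
  fun x => v @` svinv (scale_add gamma F v) x.

(* [get A] is a point of A whenever A is nonempty, hence its unique element
   when A is a singleton; see [tresolvent_unique]. *)
Definition tresolvent gamma F v : H -> H :=
  fun x => get (tresolvent_set gamma F v x).

Definition monotone_pair (dotp : {dot H for idfun}) F v : Prop :=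
  forall x y xs ys : H, F x xs -> F y ys -> 0 <= dotp (xs - ys) (v x - v y).

Lemma tresolvent_unique (dotp : {dot H for idfun}) F v gamma (x t : H) :
  induces_norm dotp -> monotone_pair dotp F v -> 0 < gamma ->
  tresolvent_set gamma F v x t -> tresolvent gamma F v x = t.
Proof.
move=> hdot mono gamma_gt0 tx; rewrite /tresolvent; apply: get_unique => // s.
case: tx => z [u Fzu eqx] <- [w [u' Fwu' eqx'] <-].
have eqv : v w - v z = gamma *: (u - u').
  apply/eqP; rewrite scalerBr subr_eq addrAC eq_sym subr_eq.
  by rewrite eqx addrC eqx'.
have := mono _ _ _ _ Fzu Fwu'.
rewrite -[v z - v w]opprB eqv linearNr linearZr_LR /= -/(_ - _) hdot oppr_ge0.
rewrite pmulr_rle0 // exprn_even_le0 //= normr_eq0 => /eqP u0.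
by apply/eqP; rewrite -subr_eq0 eqv u0 scaler0.
Qed.

End SetValuedMaps.

(* Main.v *)
(* On its full domain T := v \o (gamma F + v)^-1 is nonexpansive, and its fixed
   points are exactly the v z with 0 \in F z, so the iteration is Halpern's scheme
   for T.  The points z with z - T z = lambda (x - z) converge strongly, as
   lambda tends to 0, to a fixed point q of T.  Monotonicity of id - T compares
   x_n with such a z and yields limsup <x - q, x_n - q> <= 0, whence
   |x_(n+1) - q|^2 <= (1 - alpha_n)^2 |x_n - q|^2
                      + 2 alpha_n <x - q, x_(n+1) - q>
   forces x_n to q; the negative parts of alpha enter as a summable error. *)

Require Import Defs.
From mathcomp Require Import ring lra.

Local Open Scope classical_set_scope.
Local Open Scope ring_scope.

(** * Recursive inequalities for real sequences *)

Section RealSequences.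
Variable R : realType.
Implicit Types s a b c : nat -> R.

(** Passes from finite sums in the extended reals, the form of the hypotheses on [alpha], to
    convergent real series. *)
Lemma nneseries_fin_cvg c : (forall n, 0 <= c n) ->
  (\sum_(0 <= n <oo) (c n)%:E < +oo)%E -> cvgn (series c).
Proof.
move=> c0 hc; apply: nondecreasing_is_cvgn; first exact: nondecreasing_series.
have E0 n : (0 <= n)%N -> true -> (0 <= (c n)%:E)%E by rewrite lee_fin.
have hfin : (\sum_(0 <= n <oo) (c n)%:E)%E \is a fin_num.
  by rewrite ge0_fin_numE // nneseries_ge0.
exists (fine (\sum_(0 <= n <oo) (c n)%:E)%E) => _ [n _ <-].
rewrite -lee_fin fineK // /series /= -sumEFin.
exact: (nneseries_lim_ge n E0).
Qed.

Lemma series_tail c : cvgn (series c) -> forall e, 0 < e ->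
  exists N, forall m n, (N <= m)%N -> \sum_(m <= k < n) c k <= e.
Proof.
move=> /cauchy_cvgP/cauchy_seriesP hc e e0.
have [[A B] [[N1 _ h1] [N2 _ h2]] hAB] := hc e e0.
exists (maxn N1 N2) => m n; rewrite geq_max => /andP[m1 m2].
have [nm|mn] := leqP n m; first by rewrite big_geq // ltW.
apply: (le_trans (ler_norm _)); apply/ltW/(hAB (m, n)); split; first exact: h1.
by apply: h2 => /=; rewrite (leq_trans m2) // ltnW.
Qed.

Lemma cvg_series_shift c : cvgn (series c) -> cvgn (series (c \o S)).
Proof.
move=> hc.
have h : (fun n => series c n.+1) n @[n --> \oo] --> limn (series c).
  by rewrite (cvg_shiftS (series c)).
have -> : series (c \o S) = (fun n => series c n.+1 - c 0).
  by apply/funext => n; rewrite /series /= big_nat_recl // addrAC subrr add0r.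
by apply: cvgP; apply: cvgB h (cvg_cst _).
Qed.

(** A discrete Gronwall bound: [1 + c n <= expR (c n)] turns the product of the growth factors into
    the exponential of a tail of [c], and that tail is at most 1 from [N] on. *)
Lemma growth_bounded s c : cvgn (series c) ->
  (\forall n \near \oo, 0 <= s n) -> (forall n, 0 <= c n) ->
  (\forall n \near \oo, s n.+1 <= (1 + c n) * s n) ->
  exists M, \forall n \near \oo, s n <= M.
Proof.
move=> /series_tail /(_ 1 ltr01)[N0 hN0] [N1 _ hs] c0 [N2 _ hrec].
pose N := maxn N0 (maxn N1 N2).
have le k : (N <= k)%N -> s k <= expR (\sum_(N <= i < k) c i) * s N.
  elim: k => [|k IH].
    by rewrite leqn0 => /eqP ->; rewrite big_geq // expR0 mul1r.
  rewrite leq_eqVlt => /predU1P[<-|]; first by rewrite big_geq // expR0 mul1r.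
  rewrite ltnS => Nk; have [N1k N2k] : (N1 <= k)%N /\ (N2 <= k)%N.
    by move: Nk; rewrite /N !geq_max => /and3P[].
  apply: le_trans (hrec k N2k) _.
  rewrite big_nat_recr //= expRD.
  have := ler_pM _ _ (expR_ge1Dx (c k)) (IH Nk).
  rewrite [expR (c k) * _]mulrA [expR (c k) * _]mulrC; apply; last exact: hs.
  by rewrite addr_ge0.
exists (expR 1 * s N); exists N => // k /= Nk; apply: le_trans (le k Nk) _.
apply: ler_wpM2r; first by apply: hs; rewrite /= /N !leq_max leqnn orbT.
by rewrite ler_expR; apply: hN0; rewrite leq_maxl.
Qed.

(* With [e] bounding [b] from [N] on, the excess of [s] over [e] and the partial
   sums of [c] contracts by [1 - a n <= exp (- a n)]. *)
Lemma xu_recursion s a b c :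
  (forall n, 0 <= s n) -> (\forall n \near \oo, 0 <= a n <= 1) ->
  (\sum_(0 <= i < n) a i) @[n --> \oo] --> +oo ->
  (forall e, 0 < e -> \forall n \near \oo, b n <= e) ->
  (forall n, 0 <= c n) -> cvgn (series c) ->
  (\forall n \near \oo, s n.+1 <= (1 - a n) * s n + a n * b n + c n) ->
  s n @[n --> \oo] --> (0 : R).
Proof.
move=> s0 [N1 _ ha] suma hb c0 cc [N2 _ hrec].
apply/cvgr0Pnorm_le => e e0.
(* One third of [e] each for the decayed initial value, the bound on [b] and the tail of [c]. *)
have [d d0 ed] : exists2 d, 0 < d & e = d * 3.
  by exists (e / 3); [rewrite divr_gt0|lra].
have [N0 hN0] := series_tail cc d0.
have [N3 _ hb3] := hb d d0.
pose N := maxn (maxn N0 N1) (maxn N2 N3).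
have le k : (N <= k)%N ->
    s k <= expR (- \sum_(N <= i < k) a i) * s N + d + \sum_(N <= i < k) c i.
  elim: k => [|k IH].
    rewrite leqn0 => /eqP ->; rewrite !big_geq // oppr0 expR0 mul1r addr0.
    by rewrite lerDl ltW.
  rewrite leq_eqVlt => /predU1P[<-|].
    by rewrite !big_geq // oppr0 expR0 mul1r addr0 lerDl ltW.
  rewrite ltnS => Nk.
  have [N1k N2k N3k] : [/\ (N1 <= k)%N, (N2 <= k)%N & (N3 <= k)%N].
    by move: Nk; rewrite /N !geq_max => /andP[/andP[_ ->] /andP[-> ->]].
  apply: le_trans (hrec k N2k) _; rewrite !big_nat_recr //= opprD expRD.
  have /andP[a0 a1] := ha k N1k; have bk := hb3 k N3k.
  have C0 : 0 <= \sum_(N <= i < k) c i by rewrite sumr_ge0.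
  have ea := expR_ge1Dx (- a k).
  have E0 : 0 <= expR (- \sum_(N <= i < k) a i) * s N.
    by rewrite mulr_ge0 // expR_ge0.
  have := IH Nk; move: ea E0 C0 bk.
  rewrite -mulrA [expR (- a k) * _]mulrC mulrA.
  move: (expR (- a k)) (expR _ * s N) (\sum_(_ <= _ < _) c _) => A E C.
  move=> ea E0 C0 bk IHk.
  (* The terms [(1 - a k) * d] and [a k * d] recombine to [d]; the nonnegative [a k * C] is
     dropped. *)
  have h1 : (1 - a k) * s k <= (1 - a k) * (E + d + C).
    by apply: ler_wpM2l => //; lra.
  have h2 : a k * b k <= a k * d by exact: ler_wpM2l.
  have h3 : E * (1 - a k) <= E * A by exact: ler_wpM2l.
  have h4 : 0 <= a k * C by exact: mulr_ge0.
  lra.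
(* Once the sum [t] of [a] from [N] on reaches [s N / d], the bound [1 + t <= expR t] gives
   [expR (- t) * s N <= d]. *)
have suma' : \forall k \near \oo,
    \sum_(0 <= i < N) a i + s N / d <= \sum_(0 <= i < k) a i.
  by move/cvgryPge: suma; exact.
near=> k.
have Nk : (N <= k)%N by near: k; exact: nbhs_infty_ge.
rewrite ger0_norm //; apply: le_trans (le k Nk) _.
have tk : s N / d <= \sum_(N <= i < k) a i.
  have : \sum_(0 <= i < N) a i + s N / d <= \sum_(0 <= i < k) a i.
    by near: k.
  by rewrite [X in _ <= X](@big_cat_nat _ _ _ N) //= lerD2l.
have : \sum_(N <= i < k) c i <= d by apply: hN0; rewrite /N -maxnA leq_maxl.
suff : expR (- \sum_(N <= i < k) a i) * s N <= d by lra.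
rewrite expRN mulrC ler_pdivrMr ?expR_gt0 //.
have := expR_ge1Dx (\sum_(N <= i < k) a i).
move: tk; rewrite ler_pdivrMr // => tk.
move=> /(ler_wpM2l (ltW d0)); lra.
Unshelve. all: by end_near. Qed.

End RealSequences.

(** * Inner product inequalities *)

Section InnerProduct.
Variables (R : realType) (H : normedModType R) (dotp : {dot H for idfun}).
Hypothesis hdotp : induces_norm dotp.
Implicit Types (u w y z : H) (lambda mu : R).

Lemma dotC u w : dotp u w = dotp w u.
Proof. by rewrite hermC expr0 mul1r. Qed.

Lemma sqr_normD u w : `|u + w| ^+ 2 = `|u| ^+ 2 + 2 * dotp u w + `|w| ^+ 2.
Proof.
by rewrite -!hdotp linearDl /= !linearDr /= (dotC w u); ring.
Qed.

(** Cauchy-Schwarz, read off the triangle inequality that the norm already satisfies: square it and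
    compare with the expansion of [|u + w|^2]. *)
Lemma dot_le_norm u w : dotp u w <= `|u| * `|w|.
Proof.
have := sqr_normD u w; have := ler_normD u w.
have := normr_ge0 u; have := normr_ge0 w; have := normr_ge0 (u + w).
nra.
Qed.

(** The two sides differ by [|u|^2]. Keeping [u + w] in the inner product is what brings the new
    iterate into the Halpern estimate. *)
Lemma sqr_normD_le u w : `|u + w| ^+ 2 <= `|w| ^+ 2 + 2 * dotp u (u + w).
Proof.
have := sqr_normD u w; rewrite linearDr /= hdotp.
have := sqr_ge0 `|u|; lra.
Qed.

Lemma id_sub_nonexpansive_monotone (T : H -> H) y z :
  `|T y - T z| <= `|y - z| -> 0 <= dotp ((y - T y) - (z - T z)) (y - z).
Proof.
move=> hT; have -> : (y - T y) - (z - T z) = (y - z) - (T y - T z).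
  by rewrite !opprD addrACA.
rewrite linearBl /= hdotp subr_ge0 (le_trans (dot_le_norm _ _)) //.
by rewrite expr2 ler_wpM2r.
Qed.

(** With [P = |u|^2], [D = <u, w>] and [Q = |w|^2] the claim is [P <= D]. The hypothesis says
    [lambda (P - D) <= mu (D - Q)], and [0 <= |u - w|^2] says [D - Q <= P - D]; hence
    [(lambda - mu) (P - D) <= 0]. *)
Lemma sqr_dist_le_of_pull u w lambda mu : 0 <= mu < lambda ->
  dotp (lambda *: u - mu *: w) (u - w) <= 0 ->
  `|u - w| ^+ 2 <= `|w| ^+ 2 - `|u| ^+ 2.
Proof.
move=> /andP[mu0 mulambda]; have := sqr_ge0 `|u - w|.
rewrite -!hdotp linearBl !linearBr /= !linearBl /= !linearZl_LR /= (dotC w u).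
move: (dotp u u) (dotp u w) (dotp w w) => P D Q h1 h2.
suff : P <= D by lra.
rewrite -(ler_pM2l (_ : 0 < lambda - mu)) ?subr_gt0 //; nra.
Qed.

End InnerProduct.

(** * The approximating path and its limit *)

Section ApproximatingPath.
Variables (R : realType) (H : completeNormedModType R).
Variables (dotp : {dot H for idfun}) (hdotp : induces_norm dotp).
Variables (T : H -> H) (hT : forall y z, `|T y - T z| <= `|y - z|).
Implicit Types (x y z p q : H) (lambda : R).

(** The equation rearranges to [z = (lambda x + T z) / (1 + lambda)], whose right side is a
    contraction of ratio [1 / (1 + lambda)], so Banach's theorem applies. *)
Lemma path_point_exists x lambda : 0 < lambda ->
  exists z, z - T z = lambda *: (x - z).
Proof.
move=> l0; have l1 : 0 < 1 + lambda by rewrite addr_gt0.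
have l1' : 0 <= (1 + lambda)^-1 by rewrite invr_ge0 ltW.
pose f z := (1 + lambda)^-1 *: (lambda *: x + T z).
have ctr : is_contraction [fun of totalfun f].
  exists (NngNum l1'); split => /=; first by rewrite invf_lt1 // ltrDl.
  move=> [y z] _ /=; rewrite /totalfun_ /f -scalerBr normrZ ger0_norm //.
  rewrite ler_wpM2l //.
  by rewrite opprD addrACA subrr add0r.
have [z _ /= zf] := banach_fixed_point ctr closedT (ex_intro _ 0 I).
exists z; have : (1 + lambda) *: z = lambda *: x + T z.
  by rewrite {1}zf /f scalerA divff ?scale1r // gt_eqF.
rewrite scalerDl scale1r => h; apply/eqP.
by rewrite scalerBr subr_eq addrAC eq_sym subr_eq h.
Qed.

(* Along z_n - T z_n = (x - z_n) / (n + 1), monotonicity of id - T gives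
   |z_n - z_m|^2 <= |z_m - x|^2 - |z_n - x|^2 for n <= m, so that the distances
   to x increase and, being bounded, force (z_n) to be Cauchy. *)
Lemma path_cvg_fixpoint x p : T p = p ->
  exists q, T q = q /\ forall e, 0 < e -> exists lambda z,
    [/\ 0 < lambda, z - T z = lambda *: (x - z) & `|z - q| <= e].
Proof.
move=> Tp; pose l n : R := n.+1%:R^-1.
have l0 n : 0 < l n by rewrite invr_gt0.
have [z hz] := choice (fun n => path_point_exists x (l0 n)).
pose r n := `|z n - x| ^+ 2.
have hzr n : z n - T (z n) = - (l n *: (z n - x)).
  by rewrite hz -scalerN opprB.
(* A general [y] covers both a later [z m] and, with [mu = 0], the fixed point [p], which bounds
   [r]. *)
have dist y n (mu : R) : 0 <= mu < l n -> y - T y = - (mu *: (y - x)) ->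
    `|z n - y| ^+ 2 <= `|y - x| ^+ 2 - r n.
  move=> hmu hy.
  have e1 : z n - y = (z n - x) - (y - x) by rewrite opprB addrA addrNK.
  rewrite {1}e1 /r; apply: (sqr_dist_le_of_pull hdotp hmu).
  have := id_sub_nonexpansive_monotone hdotp (hT (z n) y).
  by rewrite -e1 hzr hy -opprD linearNl oppr_ge0.
have distnm n m : (n <= m)%N -> `|z n - z m| ^+ 2 <= r m - r n.
  rewrite leq_eqVlt => /predU1P[->|nm]; first by rewrite !subrr normr0 expr0n.
  by apply: dist (hzr m); rewrite ltW //= ltf_pV2 ?posrE // ltr_nat.
have r_nd : {homo r : n m / (n <= m)%N >-> n <= m}.
  by move=> n m /distnm h; rewrite -subr_ge0 (le_trans _ h) // sqr_ge0.
have r_cvg : cvgn r.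
  apply: nondecreasing_is_cvgn => //; exists (`|p - x| ^+ 2) => _ [n _ <-].
  rewrite -subr_ge0 (le_trans (sqr_ge0 `|z n - p|)) //.
  by apply: (dist _ _ 0); rewrite ?lexx ?l0 // Tp subrr scale0r oppr0.
have z_cvg : cvgn z.
  apply/cauchy_cvgP/cauchy_exP => e e0.
  have e2 : 0 < e ^+ 2 by rewrite exprn_gt0.
  have [N _ hN] := (@cvgrPdist_lt _ _ _ _ _ _ _).1 r_cvg _ e2.
  exists (z N); exists N => // n /= Nn; rewrite -ball_normE /=.
  rewrite -(ltr_pXn2r (_ : (0 < 2)%N)) ?nnegrE // ?(ltW e0) //.
  apply: le_lt_trans (distnm _ _ Nn) _.
  have := hN N (leqnn N); rewrite /= => /(le_lt_trans (ler_norm _)).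
  apply: le_lt_trans; rewrite lerD2r.
  exact: nondecreasing_cvgn_le.
have z_lim : forall e : R, 0 < e -> \forall n \near \oo, `|limn z - z n| <= e.
  by move=> e; move/cvgrPdist_le: z_cvg; apply.
move: (limn z) z_lim => q z_lim; exists q; split; last first.
  move=> e e0; have [N _ hN] := z_lim e e0.
  by exists (l N), (z N); split => //; rewrite distrC; apply: (hN N) => /=.
apply/eqP; rewrite eq_sym -subr_eq0 -normr_le0; apply/ler_addgt0Pl => e e0.
rewrite addr0.
(* [q - T q] splits into [q - z n], [l n] times [x - z n], and [T (z n) - T q], of norms at most
   [e / M], [e / M] times [|x - q| + 1], and [e / M]; these add up to [e]. *)
pose M := 3 + `|x - q|.
have M0 : 0 < M by rewrite /M; have := normr_ge0 (x - q); lra.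
have eM : 0 < Num.min 1 (e / M) by rewrite lt_min ltr01 divr_gt0.
have hl : \forall n \near \oo, l n < e / M.
  exact: (near_infty_natSinv_lt (PosNum (divr_gt0 e0 M0))).
have [n [/=]] := filter_ex (filterI (z_lim _ eM) hl).
rewrite le_min => /andP[qz1 qzM] ln.
have -> : q - T q = (q - z n) + ((z n - T (z n)) + (T (z n) - T q)).
  by rewrite [_ + (T _ - T _)]addrA addrNK addrA addrNK.
apply: le_trans (ler_normD _ _) _.
apply: le_trans (lerD (lexx _) (ler_normD _ _)) _.
rewrite hz normrZ gtr0_norm //.
have h1 : `|T (z n) - T q| <= `|q - z n| by rewrite [leRHS]distrC.
have h2 : `|x - z n| <= `|x - q| + 1.
  by apply: le_trans (ler_distD q _ _) _; rewrite lerD2l.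
have h3 : l n * `|x - z n| <= e / M * (`|x - q| + 1).
  by apply: ler_pM => //; exact: ltW.
have h4 : e / M * M = e by rewrite divfK // gt_eqF.
move: h3 h4 h1 qzM; rewrite /M; lra.
Qed.

End ApproximatingPath.

Lemma near_inftyS (P : nat -> Prop) :
  (\forall n \near \oo, P n) -> \forall n \near \oo, P n.+1.
Proof. by move=> [N _ h]; exists N => // n /= Nn; apply: h; exact: leqW. Qed.

(** * Halpern's iteration for a nonexpansive map *)

Section Halpern.
Variables (R : realType) (H : completeNormedModType R).
Variables (dotp : {dot H for idfun}) (hdotp : induces_norm dotp).
Variables (T : H -> H) (hT : forall y z, `|T y - T z| <= `|y - z|).
Variables (x : H) (alpha : nat -> R) (x_ : nat -> H).
Hypothesis hx_ : forall n,
  x_ n.+1 = alpha n *: x + (1 - alpha n) *: T (x_ n).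
Hypothesis alpha_cvg0 : alpha n @[n --> \oo] --> (0 : R).
Hypothesis alpha_sum : (\sum_(0 <= i < n) alpha i) @[n --> \oo] --> +oo.
Hypothesis alpha_var : cvgn (series (fun n => `|alpha n.+1 - alpha n|)).
Hypothesis alpha_neg : cvgn (series (fun n => Num.max (- alpha n) 0)).
Implicit Types (p q y z : H) (lambda e : R) (n : nat).

(** Positive and negative parts of [alpha]: [a] drives the contraction, [c] enters only as a
    summable error. *)
Let a n := Num.max (alpha n) 0.
Let c n := Num.max (- alpha n) 0.

Let alphaE n : alpha n = a n - c n.
Proof.
rewrite /a /c; have [h|h] := leP 0 (alpha n).
  by rewrite max_r ?oppr_le0 // subr0.
by rewrite max_l ?oppr_ge0 ?(ltW h) // sub0r opprK.
Qed.

Let a_ge0 n : 0 <= a n. Proof. by rewrite le_max lexx orbT. Qed.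

Let c_ge0 n : 0 <= c n. Proof. by rewrite le_max lexx orbT. Qed.

Let norm_alpha n : `|alpha n| = a n + c n.
Proof.
have [h|h] := leP 0 (alpha n).
  by rewrite ger0_norm // /a /c max_l // max_r ?oppr_le0 // addr0.
by rewrite ltr0_norm // /a /c max_r ?(ltW h) // max_l ?oppr_ge0 ?(ltW h) ?add0r.
Qed.

Let near_alpha e : 0 < e -> \forall n \near \oo, a n + c n <= e.
Proof.
move=> e0; have /cvgr0Pnorm_le /(_ e e0) := alpha_cvg0.
by apply: filterS => n; rewrite norm_alpha.
Qed.

Let norm_1Balpha n : a n + c n <= 1 -> `|1 - alpha n| = 1 - a n + c n.
Proof.
move=> h; have := a_ge0 n; have := c_ge0 n; rewrite alphaE => ? ?.
by rewrite ger0_norm; lra.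
Qed.

Let a_sum : (\sum_(0 <= i < n) a i) @[n --> \oo] --> +oo.
Proof.
apply: ger_cvgy alpha_sum; apply: nearW => n.
by apply: ler_sum => i _; rewrite le_max lexx.
Qed.

Let near_a01 : \forall n \near \oo, 0 <= a n <= 1.
Proof.
apply: filterS (near_alpha ltr01) => n; rewrite a_ge0 /=.
by apply: le_trans; rewrite lerDl.
Qed.

Let stepB p n :
  x_ n.+1 - p = alpha n *: (x - p) + (1 - alpha n) *: (T (x_ n) - p).
Proof.
rewrite hx_ !scalerBr addrACA; congr (_ + _); rewrite -opprD -scalerDl.
by rewrite addrC subrK scale1r.
Qed.

(** Once [|alpha n| <= 1], the weights satisfy [|alpha n| + |1 - alpha n| = 1 + 2 c n]. Including
    [|x - p|] in the maximum [s] bounds both weighted terms by [s n], so [growth_bounded]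
    applies. *)
Lemma halpern_bounded p : T p = p ->
  exists M, 0 <= M /\ \forall n \near \oo, `|x_ n - p| <= M.
Proof.
move=> Tp; pose s n := Num.max `|x_ n - p| `|x - p|.
have s0 n : 0 <= s n by rewrite le_max normr_ge0.
have c2 : cvgn (series (2 *: c)) by exact: is_cvg_seriesZ.
have [||| M hM] := @growth_bounded _ s _ c2.
- exact: nearW.
- by move=> n; rewrite mulr_ge0.
- apply: filterS (near_alpha ltr01) => n h1.
  have xs : `|x - p| <= s n by rewrite le_max lexx orbT.
  have xns : `|T (x_ n) - p| <= s n.
    by rewrite le_max -{1}Tp hT.
  rewrite [leLHS]/s ge_max; apply/andP; split; last first.
    by apply: le_trans xs _; rewrite ler_peMl // lerDl mulr_ge0.
  rewrite stepB (le_trans (ler_normD _ _)) // !normrZ norm_1Balpha // norm_alpha.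
  apply: (@le_trans _ _ ((a n + c n) * s n + (1 - a n + c n) * s n)).
    have := a_ge0 n; have := c_ge0 n => ? ?.
    by apply: lerD; apply: ler_wpM2l => //; lra.
  rewrite -mulrDl; have -> : (2 *: c) n = 2 * c n by [].
  by apply: ler_wpM2r => //; lra.
exists (Num.max M 0); split; first by rewrite le_max lexx orbT.
apply: filterS hM => n; rewrite /s ge_max => /andP[h _].
by rewrite le_max h.
Qed.

(** Consecutive differences tend to 0 by [xu_recursion], with the variation of [alpha] as summable
    error; then [x_ n - T (x_ n)] is such a difference plus [alpha n] times a bounded vector. *)
Lemma halpern_asymptotic_regular p : T p = p ->
  `|x_ n - T (x_ n)| @[n --> \oo] --> (0 : R).
Proof.
move=> Tp; have [M [M0 hM]] := halpern_bounded Tp.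
pose K := `|x - p| + M; have K0 : 0 <= K by rewrite addr_ge0.
have xT : \forall n \near \oo, `|x - T (x_ n)| <= K.
  apply: filterS hM => n hn; apply: le_trans (ler_distD p _ _) _.
  by rewrite lerD2l -{1}Tp (le_trans (hT _ _)) // distrC.
pose d n := `|alpha n.+1 - alpha n|.
have hxS : `|x_ n.+1 - x_ n| @[n --> \oo] --> (0 : R).
  have cS : cvgn (series (c \o S)) by exact: cvg_series_shift.
  apply: (@xu_recursion _ _ (a \o S) (fun=> 0)
                        ((2 * M) *: (c \o S) + K *: d)) => //.
  - exact: (near_inftyS near_a01).
  - have : (\sum_(0 <= i < n.+1) a i) @[n --> \oo] --> +oo.
      by rewrite (@cvg_shiftS _ (fun n => \sum_(0 <= i < n) a i)).
    move=> /cvgryPge h; apply/cvgryPge => A.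
    apply: filterS (h (a 0 + A)) => n.
    by rewrite big_nat_recl //= lerD2l.
  - by move=> e e0; apply: nearW => _; exact: ltW.
  - move=> n; have M2 : 0 <= 2 * M by rewrite mulr_ge0.
    rewrite addr_ge0 //; apply: mulr_ge0 => //; first exact: c_ge0.
    exact: normr_ge0.
  - by apply: is_cvg_seriesD; apply: is_cvg_seriesZ.
  near=> n.
  have hxn : `|x_ n - p| <= M by near: n.
  have hxSn : `|x_ n.+1 - p| <= M by near: n; exact: (near_inftyS hM).
  have hTn : `|x - T (x_ n)| <= K by near: n.
  have h1 : a n.+1 + c n.+1 <= 1.
    by near: n; exact: (near_inftyS (near_alpha ltr01)).
  (* Both iterates are expanded around the base point [T (x_ n)], which kills the [T] term of the
     earlier one. *)
  have -> : x_ n.+2 - x_ n.+1 = (alpha n.+1 - alpha n) *: (x - T (x_ n)) +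
      (1 - alpha n.+1) *: (T (x_ n.+1) - T (x_ n)).
    have -> : x_ n.+2 - x_ n.+1 = (x_ n.+2 - T (x_ n)) - (x_ n.+1 - T (x_ n)).
      by rewrite opprB addrA subrK.
    by rewrite !stepB subrr scaler0 addr0 [(_ - alpha n) *: _]scalerBl addrAC.
  apply: le_trans (ler_normD _ _) _; rewrite !normrZ norm_1Balpha //.
  rewrite mulr0 addr0.
  (* This bound turns the excess [c n.+1] of the contraction factor into an additive error. *)
  have h2 : `|x_ n.+1 - x_ n| <= 2 * M.
    apply: le_trans (ler_distD p _ _) _.
    by rewrite (mulr_natl M 2) mulr2n lerD // distrC.
  have h3 := hT (x_ n.+1) (x_ n).
  have h4 : d n * `|x - T (x_ n)| <= d n * K.
    by apply: ler_wpM2l => //; exact: normr_ge0.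
  have h5 : (1 - a n.+1 + c n.+1) * `|T (x_ n.+1) - T (x_ n)| <=
            (1 - a n.+1 + c n.+1) * `|x_ n.+1 - x_ n|.
    by apply: ler_wpM2l => //; have := c_ge0 n.+1; lra.
  have h6 : c n.+1 * `|x_ n.+1 - x_ n| <= c n.+1 * (2 * M).
    exact: ler_wpM2l.
  have -> : ((2 * M) *: (c \o succn) + K *: d) n = 2 * M * c n.+1 + K * d n.
    by [].
  rewrite /= -/(d n); lra.
apply/cvgr0Pnorm_le => e e0.
have e2 : 0 < e / 2 by rewrite divr_gt0.
(* [K + 1] rather than [K], which may vanish. *)
have eK : 0 < e / 2 / (K + 1) by rewrite divr_gt0 // ltr_wpDl.
near=> n; rewrite normr_id.
have h1 : `|x_ n.+1 - x_ n| <= e / 2.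
  near: n; move/cvgr0Pnorm_le: hxS => /(_ _ e2).
  by apply: filterS => n; rewrite normr_id.
have h2 : `|alpha n| <= e / 2 / (K + 1).
  by near: n; move/cvgr0Pnorm_le: alpha_cvg0 => /(_ _ eK).
have h3 : `|x - T (x_ n)| <= K + 1.
  by rewrite ler_wpDr //; near: n.
apply: le_trans (ler_distD (x_ n.+1) _ _) _; rewrite [`|x_ n - _|]distrC.
rewrite (stepB (T (x_ n))) subrr scaler0 addr0 normrZ.
have := ler_pM (normr_ge0 _) (normr_ge0 _) h2 h3.
by rewrite divfK ?gt_eqF ?ltr_wpDl //; lra.
Unshelve. all: by end_near. Qed.

(** For [z] on the path, [lambda <x - z, x_ n - z> = <z - T z, x_ n - z> <= <x_ n - T (x_ n), x_ n -
    z>]. Fixing [z] near [q], and with it [lambda], before [n] lets asymptotic regularity make the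
    right side small. *)
Lemma halpern_limsup q : T q = q ->
  (forall e, 0 < e -> exists lambda z,
    [/\ 0 < lambda, z - T z = lambda *: (x - z) & `|z - q| <= e]) ->
  forall e, 0 < e -> \forall n \near \oo, dotp (x - q) (x_ n - q) <= e.
Proof.
move=> Tq hq e e0; have [M [M0 hM]] := halpern_bounded Tq.
(* Replacing [z] by [q] costs [e / 2 / L] times [M + 1] and times [|x - q|], together [e / 2]. *)
pose L := M + 1 + `|x - q|.
have L0 : 0 < L by rewrite /L; have := normr_ge0 (x - q); lra.
have e2L : 0 < e / 2 / L by rewrite !divr_gt0.
have [|lambda [z [l0 hz]]] := hq (Num.min 1 (e / 2 / L)).
  by rewrite lt_min ltr01.
rewrite le_min => /andP[zq1 zqe].
have hreg : \forall n \near \oo,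
    `|x_ n - T (x_ n)| <= lambda * (e / 2) / (M + 1).
  have /cvgr0Pnorm_le := halpern_asymptotic_regular Tq.
  move=> /(_ (lambda * (e / 2) / (M + 1))).
  have -> : 0 < lambda * (e / 2) / (M + 1).
    by rewrite divr_gt0 ?mulr_gt0 ?divr_gt0 // ltr_wpDl.
  by move=> /(_ isT); apply: filterS => n; rewrite normr_id.
near=> n.
have hn : `|x_ n - q| <= M by near: n.
have hAn : `|x_ n - T (x_ n)| <= lambda * (e / 2) / (M + 1) by near: n.
have hzn : `|x_ n - z| <= M + 1.
  by apply: le_trans (ler_distD q _ _) _; rewrite lerD // distrC.
have h1 : dotp (x - z) (x_ n - z) <= e / 2.
  rewrite -(ler_pM2l l0).
  have := id_sub_nonexpansive_monotone hdotp (hT (x_ n) z).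
  rewrite hz linearBl /= linearZl_LR /= subr_ge0 => /le_trans; apply.
  apply: le_trans (dot_le_norm hdotp _ _) _.
  have := ler_pM (normr_ge0 _) (normr_ge0 _) hAn hzn.
  by rewrite divfK ?gt_eqF ?ltr_wpDl.
have h2 : dotp (z - q) (x_ n - z) <= e / 2 / L * (M + 1).
  by apply: le_trans (dot_le_norm hdotp _ _) _; apply: ler_pM.
have h3 : dotp (x - q) (z - q) <= e / 2 / L * `|x - q|.
  by apply: le_trans (dot_le_norm hdotp _ _) _; rewrite mulrC ler_wpM2r.
have h4 : e / 2 / L * L = e / 2 by rewrite divfK // gt_eqF.
have -> : dotp (x - q) (x_ n - q) =
    dotp (x - z) (x_ n - z) + dotp (z - q) (x_ n - z) + dotp (x - q) (z - q).
  by rewrite -linearDl /= addrA addrNK -linearDr /= addrA addrNK.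
by move: h4; rewrite {2}/L; lra.
Unshelve. all: by end_near. Qed.

Theorem halpern_cvg p : T p = p ->
  exists q, T q = q /\ x_ n @[n --> \oo] --> q.
Proof.
move=> Tp; have [q [Tq hq]] := path_cvg_fixpoint hdotp hT x Tp.
exists q; split => //.
have [M [M0 hM]] := halpern_bounded Tq.
pose s n := `|x_ n - q| ^+ 2.
(* Collects the cost of [c n]: [3 * M ^+ 2] from [(1 - a n + c n)^2 <= 1 - a n + 3 c n], and the
   rest from the inner product weighted by [- 2 c n]. *)
pose K := 3 * M ^+ 2 + 2 * (`|x - q| * M).
have K0 : 0 <= K by rewrite addr_ge0 // mulr_ge0 // ?sqr_ge0 // mulr_ge0.
have : s n @[n --> \oo] --> (0 : R).
  apply: (@xu_recursion _ _ a (fun n => 2 * dotp (x - q) (x_ n.+1 - q)) (K *: c)).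
  - by move=> n; exact: sqr_ge0.
  - exact: near_a01.
  - exact: a_sum.
  - move=> e e0; have e2 : 0 < e / 2 by rewrite divr_gt0.
    apply: filterS (near_inftyS (halpern_limsup Tq hq e2)) => n /=; lra.
  - by move=> n; rewrite mulr_ge0.
  - exact: is_cvg_seriesZ.
  near=> n.
  have hxn : `|x_ n - q| <= M by near: n.
  have hxSn : `|x_ n.+1 - q| <= M by near: n; exact: (near_inftyS hM).
  have hac : a n + c n <= 1 by near: n; exact: near_alpha.
  rewrite /s {1}stepB (le_trans (sqr_normD_le hdotp _ _)) // -stepB.
  rewrite normrZ exprMn norm_1Balpha // [dotp (_ *: _) _]linearZl_LR /=.
  have hTn : `|T (x_ n) - q| ^+ 2 <= `|x_ n - q| ^+ 2.
    by rewrite ler_pXn2r ?nnegrE // -{1}Tq hT.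
  have hsM : `|x_ n - q| ^+ 2 <= M ^+ 2 by rewrite ler_pXn2r ?nnegrE.
  have hb : - dotp (x - q) (x_ n.+1 - q) <= `|x - q| * M.
    rewrite -linearNl /= (le_trans (dot_le_norm hdotp _ _)) // normrN.
    exact: ler_wpM2l.
  have -> : (K *: c) n = K * c n by [].
  rewrite alphaE /= /K.
  have := a_ge0 n; have := c_ge0 n; have := sqr_ge0 `|T (x_ n) - q|.
  move: hac hTn hsM hb; move: (a n) (c n) => A C.
  move: (dotp _ _) (`|T _ - _| ^+ 2) (`|x_ n - _| ^+ 2) (M ^+ 2) (`|_| * M).
  move=> D t S M2 B hac hTn hsM hb t0 C0 A0.
  have AC : 0 <= A * C by exact: mulr_ge0.
  have h1 : (1 - A + C) ^+ 2 <= 1 - A + 3 * C by nra.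
  have h2 : (1 - A + C) ^+ 2 * t <= (1 - A + 3 * C) * t by exact: ler_wpM2r.
  have h3 : (1 - A) * t <= (1 - A) * S by apply: ler_wpM2l => //; lra.
  have h4 : C * t <= C * M2 by apply: ler_wpM2l => //; lra.
  have h5 : C * - D <= C * B by exact: ler_wpM2l.
  lra.
move=> /cvgr0Pnorm_le hs; apply/cvgrPdist_le => e e0.
have := hs (e ^+ 2) (exprn_gt0 _ e0); apply: filterS => n.
rewrite ger0_norm ?sqr_ge0 // /s ler_pXn2r ?nnegrE ?(ltW e0) //.
by rewrite distrC.
Unshelve. all: by end_near. Qed.

End Halpern.

(** * The transformed resolvent as a nonexpansive map *)

Section TransformedResolvent.
Variables (R : realType) (H : normedModType R).
Variables (dotp : {dot H for idfun}) (hdotp : induces_norm dotp).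
Variables (F : H -> set H) (v : H -> H) (gamma : R).
Hypotheses (hmono : monotone_pair dotp F v) (hgamma : 0 < gamma).
Hypothesis hran : ran (scale_add gamma F v) = [set: H].

Lemma tresolvent_val z u : F z u -> tresolvent gamma F v (gamma *: u + v z) = v z.
Proof.
move=> Fzu; apply: (tresolvent_unique hdotp hmono hgamma).
by exists z => //; exists u.
Qed.

Lemma tresolvent_preimage y : exists z u, F z u /\ y = gamma *: u + v z.
Proof.
have [z _ [u Fzu <-]] : ran (scale_add gamma F v) y by rewrite hran.
by exists z, u.
Qed.

(** Writing both points as [gamma u + v w], the squared distance expands with a cross term that
    monotonicity makes nonnegative; dropping it and the [gamma] square leaves the distance of the
    images. *)
Lemma tresolvent_nonexpansive y z :
  `|tresolvent gamma F v y - tresolvent gamma F v z| <= `|y - z|.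
Proof.
have [w [u [Fwu ->]]] := tresolvent_preimage y.
have [w' [u' [Fwu' ->]]] := tresolvent_preimage z.
rewrite !tresolvent_val // opprD addrACA -scalerBr.
have h := hmono Fwu Fwu'.
rewrite -(ler_pXn2r (_ : (0 < 2)%N)) ?nnegrE //.
rewrite [leRHS](sqr_normD hdotp).
have -> : dotp (gamma *: (u - u')) (v w - v w') =
    gamma * dotp (u - u') (v w - v w') by rewrite linearZl_LR.
by rewrite lerDr addr_ge0 ?sqr_ge0 // !mulr_ge0 // ltW.
Qed.

(** If [p = gamma u + v z] with [u] in [F z], its image is [v z], so [p] is fixed exactly when
    [u = 0]. *)
Lemma tresolvent_fixpointP p :
  tresolvent gamma F v p = p <-> exists z, zer F z /\ v z = p.
Proof.
split=> [|[z [Fz0 <-]]].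
  have [z [u [Fzu ->]]] := tresolvent_preimage p.
  rewrite tresolvent_val // => h; exists z; split=> //.
  move/eqP: h; rewrite eq_sym -subr_eq0 addrK scaler_eq0 gt_eqF //= => /eqP u0.
  by rewrite /zer /= -u0.
by have := tresolvent_val Fz0; rewrite scaler0 add0r.
Qed.

End TransformedResolvent.

Theorem theorem4p6 (R : realType) (H : completeNormedModType R)
    (dotp : {dot H for idfun}) (hdotp : induces_norm dotp)
    (F : H -> set H) (hzer : zer F !=set0)
    (v : H -> H) (hmono : monotone_pair dotp F v)
    (gamma : R) (hgamma : 0 < gamma)
    (hran : ran (scale_add gamma F v) = [set: H])
    (x : H) (alpha : nat -> R) (x_ : nat -> H)
    (hx_ : forall k : nat,
      x_ k.+1 = alpha k *: x + (1 - alpha k) *: tresolvent gamma F v (x_ k))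
    (halpha0 : alpha n @[n --> \oo] --> (0 : R))
    (halpha_sum : (\sum_(0 <= i < n) alpha i) @[n --> \oo] --> +oo)
    (halpha_var : (\sum_(0 <= n <oo) (`|alpha n.+1 - alpha n|)%:E < +oo)%E)
    (* vacuous when alpha is nonnegative: for signed alpha, divergence of the
       sum to +oo is read as that of a family of reals, i.e. with summable
       negative parts; without it the conclusion fails (F the normal cone of
       [0, 1] in R, v = id, x = 2) *)
    (halpha_neg : (\sum_(0 <= n <oo) (Num.max (- alpha n) 0)%:E < +oo)%E) :
  exists xt : H,
    x_ n @[n --> \oo] --> xt /\ (v @^-1` [set xt]) `&` zer F !=set0.
Proof.
have [z0 Fz0] := hzer.
have Tp : tresolvent gamma F v (v z0) = v z0.
  by apply/(tresolvent_fixpointP hdotp hmono hgamma hran); exists z0.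
have [||q [Tq xq]] := halpern_cvg hdotp
  (tresolvent_nonexpansive hdotp hmono hgamma hran) hx_ halpha0 halpha_sum _ _ Tp.
- by apply: nneseries_fin_cvg.
- by apply: nneseries_fin_cvg halpha_neg => n; rewrite le_max lexx orbT.
have [z [Fz vz]] := (tresolvent_fixpointP hdotp hmono hgamma hran q).1 Tq.
by exists q; split=> //; exists z.
Qed.
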